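(* Let $d\ge 0$ and $n_0,\dots,n_{2d}\ge 0$ be integers with $(d,n_0)\neq(0,0)$ in case $d=0$, and let $\boldsymbol{k}$ be the (non-empty, admissible) index $$\boldsymbol{k}=(\{2\}^{n_0},1,\{2\}^{n_1},3,\{2\}^{n_2},1,\{2\}^{n_3},3,\dots,\{2\}^{n_{2d-2}},1,\{2\}^{n_{2d-1}},3,\{2\}^{n_{2d}}).$$ Let $r$ and $r'$ be the depths of $\boldsymbol{k}$ and of its dual index $\boldsymbol{k}^\dagger$. Then for every non-negative integer $m$, $$\sum_{\substack{\boldsymbol{e}\in\mathbb{Z}_{\ge0}^{r}\\ |\boldsymbol{e}|=m}}\mathcal{O}(\boldsymbol{k}\oplus\boldsymbol{e})=\sum_{\substack{\boldsymbol{e}'\in\mathbb{Z}_{\ge0}^{r'}\\ |\boldsymbol{e}'|=m}}\mathcal{O}(\boldsymbol{k}^\dagger\oplus\boldsymbol{e}')$$ in $\mathbb{R}[[X]]$; or equivalently, for all non-negative integers $m_1,m_2$, $$\sum_{\substack{\boldsymbol{e}_1\in\mathbb{Z}_{\ge0}^{r}\\ |\boldsymbol{e}_1|=m_1}}\ \sum_{\substack{\boldsymbol{e}_2\in\mathbb{Z}_{\ge0}^{r}\\ |\boldsymbol{e}_2|=m_2}}\zeta(\boldsymbol{k}\oplus\boldsymbol{e}_1\oplus\boldsymbol{e}_2)=\sum_{\substack{\boldsymbol{e}'_1\in\mathbb{Z}_{\ge0}^{r'}\\ |\boldsymbol{e}'_1|=m_1}}\ \sum_{\substack{\boldsymbol{e}'_2\in\mathbb{Z}_{\ge0}^{r'}\\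 |\boldsymbol{e}'_2|=m_2}}\zeta(\boldsymbol{k}^\dagger\oplus\boldsymbol{e}'_1\oplus\boldsymbol{e}'_2).$$
   Context: An index is a finite sequence $\boldsymbol{k}=(k_1,\dots,k_r)$ of positive integers; $r$ is its depth and $|\boldsymbol{k}|=k_1+\cdots+k_r$ its weight (for $\boldsymbol{e}\in\mathbb{Z}_{\ge0}^r$, $|\boldsymbol{e}|$ also denotes the sum of the components). A (non-empty) index is admissible if its last component is greater than $1$. $\{a\}^n$ denotes $a$ repeated $n$ times (nothing if $n=0$). For $d=0$ the index $\boldsymbol{k}$ of the claim is $(\{2\}^{n_0})$. Multiple zeta values: for an admissible index, $\zeta(k_1,\dots,k_r)=\sum_{1\le m_1<\cdots<m_r}\frac{1}{m_1^{k_1}\cdots m_r^{k_r}}\in\mathbb{R}$. Dual index: every admissible index can be written uniquely as $\boldsymbol{k}=(\{1\}^{a_1-1},b_1+1,\dots,\{1\}^{a_l-1},b_l+1)$ with $l\ge1$ and all $a_p,b_q\ge1$; then $\boldsymbol{k}^\dagger:=(\{1\}^{b_l-1},a_l+1,\dots,\{1\}^{b_1-1},a_1+1)$. For two sequences of the same length, $\oplus$ denotes componentwise addition. Ohno sums: for an admissible index $\boldsymbol{k}$ of depth $r$ and $m\ge0$, $\mathcal{O}_m(\boldsymbol{k}):=\sum_{\boldsymbol{e}\in\mathbb{Z}_{\ge0}^r,\,|\boldsymbol{e}|=m}\zeta(\boldsymbol{k}\oplus\boldsymbol{e})\in\mathbb{R}$ and $\mathcal{O}(\boldsymbol{k}):=\sum_{m=0}^\infty\mathcal{O}_m(\boldsymbol{k})X^m\in\mathbb{R}[[X]]$.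 *)

(* Defs.v *)
From mathcomp Require Import all_boot all_order all_algebra.
From mathcomp Require Import all_classical all_reals all_analysis.

Set Implicit Arguments.
Unset Strict Implicit.
Unset Printing Implicit Defensive.

Import GRing.Theory.

Local Open Scope ring_scope.

(* An index is a [seq nat] with positive entries; its depth is its [size]. *)
Definition is_index (k : seq nat) : bool := all (leq 1) k.

Definition admissible (k : seq nat) : bool :=
  [&& is_index k, k != [::] & (1 < last 0 k)%N].

(* [zip] truncates to the shorter argument, so this is only meaningful for
   sequences of the same size. *)
Definition index_add (k e : seq nat) : seq nat :=
  [seq (p.1 + p.2)%N | p <- zip k e].

Notation "k \oplus e" := (index_add k e) (at level 50, left associativity).

(* [path ltn 0 m] says 0 < m_1 < ... < m_r.  The sum of nonnegative terms is
   taken in [\bar R]; [fine] is a junk value (0) only when the series diverges,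
   which does not happen for admissible [k]. *)
Definition zeta (R : realType) (k : seq nat) : R :=
  fine (\esum_(m in [set m : seq nat | size m = size k /\ path ltn 0%N m])
          (\prod_(p <- zip m k) (p.1%:R : R) ^- p.2)%:E)%E.

(* The vectors e in Z_{>=0}^r with |e| = m; see [mem_wcomp], [uniq_wcomp]. *)
Fixpoint wcomp (r m : nat) : seq (seq nat) :=
  if r is r'.+1 then [seq i :: e | i <- iota 0 m.+1, e <- wcomp r' (m - i)]
  else if m == 0%N then [:: [::]] else [::].

Lemma wcompS (r m : nat) :
  wcomp r.+1 m = [seq i :: e | i <- iota 0 m.+1, e <- wcomp r (m - i)].
Proof. by []. Qed.

Lemma mem_wcomp (r m : nat) (e : seq nat) :
  (e \in wcomp r m) = (size e == r) && (sumn e == m).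
Proof.
elim: r m e => [|r IHr] m e.
  by case: m e => [|m] [|i e].
rewrite wcompS; apply/allpairsPdep/idP => [[i [f []]]|].
  rewrite (mem_iota 0 m.+1) add0n ltnS => le_im; rewrite IHr => /andP[/eqP sf /eqP Sf] ->.
  by rewrite /= sf eqxx Sf subnKC // eqxx.
case: e => [//|i e] /=; rewrite eqSS => /andP[/eqP se /eqP Se].
exists i, e; rewrite (mem_iota 0 m.+1) add0n ltnS -Se leq_addr IHr se addKn !eqxx.
by split.
Qed.

Lemma uniq_wcomp (r m : nat) : uniq (wcomp r m).
Proof.
elim: r m => [|r IHr] m; first by rewrite /=; case: (m == 0%N).
rewrite wcompS; apply: allpairs_uniq_dep => [|i _|]; [exact: iota_uniq | exact: IHr |].
by move=> [i e] [j f] _ _ /= [-> ->].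
Qed.

Definition ohno (R : realType) (m : nat) (k : seq nat) : R :=
  \sum_(e <- wcomp (size k) m) zeta R (k \oplus e).

(* A formal power series in R[[X]] is represented by its sequence of
   coefficients; addition in [nat -> R] is pointwise. *)
Definition ohno_series (R : realType) (k : seq nat) : nat -> R :=
  fun m => ohno R m k.

(* [:: (a_1, b_1); ...; (a_l, b_l)] encodes
   ({1}^(a_1 - 1), b_1 + 1, ..., {1}^(a_l - 1), b_l + 1). *)
Definition of_blocks (s : seq (nat * nat)) : seq nat :=
  flatten [seq rcons (nseq p.1.-1 1%N) p.2.+1 | p <- s].

(* [a] is the number of leading 1s of the current block read so far, plus 1. *)
Fixpoint blocks_rec (a : nat) (k : seq nat) : seq (nat * nat) :=
  if k is x :: k' then
    if x == 1%N then blocks_rec a.+1 k' else (a, x.-1) :: blocks_rec 1 k'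
  else [::].

Definition blocks (k : seq nat) : seq (nat * nat) := blocks_rec 1 k.

Definition pos_blocks (s : seq (nat * nat)) : bool :=
  all (fun p => (0 < p.1)%N && (0 < p.2)%N) s.

(* [blocksK], [pos_blocks_blocks] and [of_blocksK] are the existence and the
   uniqueness of the block decomposition of an admissible index. *)
Lemma blocksK (k : seq nat) : admissible k -> of_blocks (blocks k) = k.
Proof.
rewrite /admissible /is_index => /and3P[].
have H a l : all (leq 1) l -> l != [::] -> (1 < last 0 l)%N ->
    of_blocks (blocks_rec a.+1 l) = nseq a 1%N ++ l.
  elim: l a => [//|x l IHl] a /= /andP[x1 l1] _ lst.
  have [x_eq1|x_neq1] := eqVneq x 1%N.
    have l_n0 : l != [::] by case: l lst {IHl l1} => //=; rewrite x_eq1.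
    have lst' : (1 < last 0 l)%N by case: l lst l_n0 {IHl l1}.
    rewrite IHl // x_eq1 -cat_rcons; congr (_ ++ _).
    by elim: a => //= a <-.
  rewrite /of_blocks /= -/(of_blocks _) cat_rcons prednK //.
  congr (_ ++ _ :: _); case: l lst l1 IHl => [//|y l] lst l1 IHl.
  by rewrite (IHl 0%N).
by move=> k1 k_n0 lst; rewrite /blocks H.
Qed.

Lemma pos_blocks_blocks (k : seq nat) : is_index k -> pos_blocks (blocks k).
Proof.
suff H a : (0 < a)%N -> is_index k -> pos_blocks (blocks_rec a k) by exact: H.
elim: k a => [//|x k IHk] a a0 /= /andP[x1 k1].
case: eqVneq => x_1; first exact: IHk.
by rewrite /= a0 [pos_blocks _]IHk // andbT; case: x x1 x_1 => [|[]].
Qed.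

Lemma of_blocksK (s : seq (nat * nat)) :
  pos_blocks s -> blocks (of_blocks s) = s.
Proof.
rewrite /blocks; elim: s => [//|[a b] s IHs] /= /andP[/andP[/= a0 b0] s0].
rewrite /of_blocks /= -/(of_blocks s) cat_rcons.
have H c n t : blocks_rec c (nseq n 1%N ++ b.+1 :: t) = (c + n, b)%N :: blocks_rec 1 t.
  elim: n c => [|n IHn] c /=; first by rewrite addn0; case: b b0.
  by rewrite IHn addSnnS.
by rewrite H IHs // add1n prednK.
Qed.

Definition dual (k : seq nat) : seq nat :=
  of_blocks (rev [seq (p.2, p.1) | p <- blocks k]).

(* ({2}^(n_0), 1, {2}^(n_1), 3, {2}^(n_2), ..., 1, {2}^(n_(2d-1)), 3,
   {2}^(n_(2d))) *)
Definition index_213 (d : nat) (n : (2 * d).+1.-tuple nat) : seq nat :=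
  nseq (nth 0 n 0)%N 2%N ++
  flatten [seq 1%N :: nseq (nth 0 n (2 * i + 1))%N 2%N ++
               3%N :: nseq (nth 0 n (2 * i + 2))%N 2%N | i <- iota 0 d].

Lemma index_213_admissible (d : nat) (n : (2 * d).+1.-tuple nat) :
  (d, nth 0 n 0)%N != (0, 0)%N -> admissible (index_213 n).
Proof.
rewrite /admissible /is_index /index_213 => H.
have a2 q : all (leq 1) (nseq q 2%N) by rewrite all_nseq orbT.
have l2 x q : (1 < x)%N -> (1 < last x (nseq q 2%N))%N by case: q => // q _; elim: q.
apply/and3P; split.
- by rewrite all_cat a2; elim: (iota 0 d) => //= i s IHs; rewrite !(all_cat, a2) /= a2.
- case: d n H => [|d] n; last by case: (nseq _ _).
  by case: (nth _ _ _).
- case: d n H => [|d] n H.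
    by rewrite /= cats0; case: (nth _ _ _) H => //= q _; exact: l2.
  have -> : iota 0 d.+1 = iota 0 d ++ [:: d] by rewrite -addn1 iotaD.
  rewrite map_cat flatten_cat /= cats0.
  by rewrite !last_cat /= last_cat /= l2.
Qed.

(* Main.v *)
Require Import Defs.
From mathcomp Require Import all_boot all_order all_algebra.
From mathcomp Require Import all_classical all_reals all_analysis.
From mathcomp Require Import ring lra.

(* For 0 < x, y <= 1/4 the double generating function in x, y of the sums of
   the theorem is the nested sum over m_1 < ... < m_r with weights
   m^(2-c) / P(m), where c is the entry of the index and P(m) = (m - x)(m - y).
   Two symmetric connectors C and D on pairs of naturals carry entries of such
   nested sums from one variable to the other (connected sum method):
   summation against 1/P on either variable of C, and likewise of D, gives the
   same result, and summation of D against m / P(m) gives C divided by the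
   other variable.  D is a quotient of shifted factorials; C has no closed form.
   Hence the words 2 and 1,2,...,2,3 cross C unchanged, and since C is constant
   on the two axes, reversing a list of such words, which is duality, preserves
   the generating function.  Comparing coefficients in x and y ends the proof. *)

Set Implicit Arguments.
Unset Strict Implicit.
Unset Printing Implicit Defensive.

Import Order.TTheory GRing.Theory Num.Theory.
Import numFieldNormedType.Exports.

Local Open Scope classical_set_scope.
Local Open Scope ring_scope.

(** * Nested sums *)

Section Chain.
Local Open Scope ereal_scope.
Context {R : realType}.
Implicit Types (wt : nat -> nat -> R) (k l : seq nat) (h g : nat -> \bar R).

(** The nested sum over m < a_1 < ... < a_r of the product of the [wt k_i a_i] times [h a_r]. Viewed
    as an operator on [h], it turns concatenation of words into composition; values in [\bar R] keep
    rearrangements of nonnegative terms free of convergence conditions. *)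
Fixpoint chain wt k h : nat -> \bar R :=
  if k is c :: k' then
    fun m => \sum_(0 <= a <oo | (m < a)%N) (wt c a)%:E * chain wt k' h a
  else h.

Lemma chain_cat wt k l h : chain wt (k ++ l) h = chain wt k (chain wt l h).
Proof. by elim: k => //= c k ->. Qed.

Lemma chain_ge0 wt k h : (forall c a, (0 <= wt c a)%R) ->
  (forall a, 0 <= h a) -> forall m, 0 <= chain wt k h m.
Proof.
move=> wt0 h0; elim: k => //= c k IHk m.
by apply: nneseries_ge0 => a _ _; rewrite mule_ge0 ?lee_fin.
Qed.

Lemma chainZ wt k h (r : R) : (forall c a, (0 <= wt c a)%R) ->
  (forall a, 0 <= h a) ->
  forall m, chain wt k (fun a => r%:E * h a) m = r%:E * chain wt k h m.
Proof.
move=> wt0 h0; elim: k => //= c k IHk m.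
rewrite -nneseriesZl; last by move=> a _; rewrite mule_ge0 ?lee_fin ?chain_ge0.
by apply: eq_eseriesr => a _; rewrite IHk muleCA.
Qed.

Lemma chain_nneseries wt k (H : nat -> nat -> \bar R) (P : pred nat) :
  (forall c a, (0 <= wt c a)%R) -> (forall b a, 0 <= H b a) ->
  forall m, chain wt k (fun a => \sum_(0 <= b <oo | P b) H b a) m =
            \sum_(0 <= b <oo | P b) chain wt k (H b) m.
Proof.
move=> wt0 H0; elim: k => //= c k IHk m.
rewrite nneseries_interchange; last first.
  by move=> b a; rewrite mule_ge0 ?lee_fin ?chain_ge0.
apply: eq_eseriesr => a _.
by rewrite IHk -nneseriesZl // => b _; rewrite chain_ge0.
Qed.

(** Tonelli: sums acting on the two variables of a connector commute. *)
Lemma chain_interchange wt k l (H : nat -> nat -> \bar R) :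
  (forall c a, (0 <= wt c a)%R) -> (forall a b, 0 <= H a b) -> forall m n,
  chain wt k (fun a => chain wt l (H a) n) m =
  chain wt l (fun b => chain wt k (H^~ b) m) n.
Proof.
move=> wt0 H0; elim: l => //= c l IHl m n.
rewrite chain_nneseries //; last first.
  by move=> b a; rewrite mule_ge0 ?lee_fin ?chain_ge0.
apply: eq_eseriesr => b _.
by rewrite chainZ // ?IHl// => a; rewrite chain_ge0.
Qed.

Lemma esumZl (T : choiceType) (S : set T) (f : T -> \bar R) (r : R) :
  (0 <= r)%R -> (forall i, 0 <= f i) ->
  \esum_(i in S) (r%:E * f i) = r%:E * \esum_(i in S) f i.
Proof.
move=> r0 f0; rewrite /esum -ereal_supZl //; last first.
  apply/set0P; exists 0; exists set0 => //=; first exact: fsets_set0.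
  by rewrite fsbig_set0.
rewrite image_comp; congr ereal_sup; apply: eq_imagel => A _ /=.
by rewrite ge0_mule_fsumr.
Qed.

Lemma chain_esum k m0 :
  chain (fun c a => a%:R ^- c)%R k (fun=> 1) m0 =
  \esum_(m in [set m : seq nat | size m = size k /\ path ltn m0 m])
     ((\prod_(p <- zip m k) (p.1%:R : R) ^- p.2)%R)%:E.
Proof.
have pr0 (s : seq (nat * nat)) : 0 <= ((\prod_(p <- s) (p.1%:R : R) ^- p.2)%R)%:E.
  by rewrite lee_fin prodr_ge0 // => p _; rewrite invr_ge0 exprn_ge0.
elim: k m0 => [|c k IHk] m0 /=.
  have -> : [set m : seq nat | size m = 0%N /\ path ltn m0 m] = [set [::]].
    by apply/seteqP; split => [[|a m] [] //|m /= ->].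
  by rewrite esum_set1 //= ?big_nil.
rewrite nneseries_esum; last first.
  by move=> a _; rewrite mule_ge0 ?chain_ge0// ?lee_fin ?invr_ge0 ?exprn_ge0//
     => b d; rewrite ?invr_ge0 ?exprn_ge0.
under eq_esum => a _.
  rewrite IHk -esumZl ?invr_ge0 ?exprn_ge0//; over.
rewrite esum_esum; last by move=> i j _ _; rewrite mule_ge0// lee_fin invr_ge0 exprn_ge0.
(* An increasing sequence above [m0] is a head a > m0 followed by an increasing sequence above a. *)
rewrite [RHS](reindex_esum ([set x | (m0 < x)%N] `*``
   (fun a => [set m : seq nat | size m = size k /\ path ltn a m]))
   _ (fun p => p.1 :: p.2)).
  by apply: eq_esum => -[a m] _ /=; rewrite big_cons.
split => [[a m] /= [? [-> ->]]|[a m] [b p] _ _ /= [-> ->] //|].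
  by rewrite andbT.
move=> [|a m] /= [] // [sm] /andP[lt_a pm]; by exists (a, m).
Qed.

End Chain.

(** * Power series with nonnegative coefficients *)

Section PowerSeries.
Local Open Scope ereal_scope.
Context {R : realType}.

(** [V] may be infinite: unless all [u i] vanish, both sides are then infinite. *)
Lemma nneseriesZr (u : nat -> R) (V : \bar R) :
  (forall i, (0 <= u i)%R) -> 0 <= V ->
  (\sum_(0 <= i <oo) (u i)%:E) * V = \sum_(0 <= i <oo) (u i)%:E * V.
Proof.
move=> u0; case: V => [v _| _ |//].
  rewrite muleC -nneseriesZl => [|i _]; last by rewrite lee_fin.
  by apply: eq_eseriesr => i _; rewrite muleC.
have [u_eq0|] := pselect (forall i, u i = 0%R).
  by rewrite !eseries0 ?mul0e// => i _ _; rewrite u_eq0 ?mul0e.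
move=> /existsNP[i /eqP u_neq0].
have ui : 0 < (u i)%:E by rewrite lte_fin lt0r u_neq0 u0.
rewrite gt0_muley; last first.
  apply: lt_le_trans ui _.
  rewrite (@nneseriesD1 _ _ i) //= ?leeDl ?nneseries_ge0// => *; exact: u0.
apply/esym/eqP; rewrite -leye_eq (@nneseriesD1 _ _ i) //=; last first.
  by move=> j _; rewrite mule_ge0 ?lee_fin.
rewrite gt0_muley // leeDl// nneseries_ge0 // => j _ _.
by rewrite mule_ge0 ?lee_fin.
Qed.

Lemma nneseries_Cauchy (w : nat -> nat -> \bar R) : (forall i j, 0 <= w i j) ->
  \sum_(0 <= i <oo) \sum_(0 <= j <oo) w i j =
  \sum_(0 <= N <oo) (\sum_(i <- iota 0 N.+1) w i (N - i)%N).
Proof.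
move=> w0.
(* Row [i] is delayed by [i] and padded with zeros, so that after the interchange column [N] holds
   the terms with i + j = N. *)
transitivity (\sum_(0 <= i <oo) \sum_(0 <= N <oo)
    if (i <= N)%N then w i (N - i)%N else 0).
  apply: eq_eseriesr => i _; rewrite -eseries_mkcond.
  rewrite -[RHS](@ereal_series _ (fun N => w i (N - i)%N)) -(@nneseries_addn _ _ i) //.
  by apply: eq_eseriesr => j _; rewrite addnK.
rewrite nneseries_interchange; last by move=> i N; case: ifP.
apply: eq_eseriesr => N _.
rewrite (nneseries_split 0 N.+1); last by move=> i _; case: ifP.
rewrite add0n [X in _ + X]eseries0 ?adde0; last first.
  by move=> i Ni _; rewrite leqNgt Ni.
rewrite /index_iota subn0 !big_seq; apply: eq_bigr => i.
by rewrite mem_iota add0n ltnS => /= ->.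
Qed.

(** Induction on [k]: the expansion of the first weight and the series of the remaining entries are
    combined by a Cauchy product, and splitting N as i + (N - i) is the recursion of [wcomp]. It
    serves once for x and once for y. *)
Lemma chain_series (x : R) (f g : nat -> nat -> R) (k : seq nat) :
  (0 <= x)%R -> (forall c a, (0 <= g c a)%R) ->
  (forall c a, (0 < a)%N ->
    \sum_(0 <= i <oo) (x ^+ i * g (c + i)%N a)%:E = (f c a)%:E) ->
  forall m, chain f k (fun=> 1) m =
    \sum_(0 <= N <oo)
      (x ^+ N)%:E * (\sum_(e <- wcomp (size k) N) chain g (k \oplus e) (fun=> 1) m).
Proof.
move=> x0 g0 fE; elim: k => [|c k IHk] m.
  rewrite (@nneseriesD1 _ _ 0) //=; last first.
    move=> i _; rewrite mule_ge0 ?lee_fin ?exprn_ge0//.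
    by case: i => [|i] /=; rewrite ?big_seq1 ?big_nil.
  rewrite big_seq1 mul1e [X in _ + X]eseries0 ?adde0// => i _.
  by case: i => //= i _; rewrite big_nil mule0.
have xg0 c' a i : (0 <= x ^+ i * g c' a)%R by rewrite mulr_ge0 ?exprn_ge0.
have ch0 l a : 0 <= chain g l (fun=> 1) a by apply: chain_ge0.
have S0 (I : Type) (s : seq I) (F : I -> seq nat) a :
    0 <= \sum_(e <- s) chain g (F e) (fun=> 1) a.
  by apply: sume_ge0.
rewrite [LHS]/=.
transitivity (\sum_(0 <= a <oo | (m < a)%N) \sum_(0 <= N <oo)
    (x ^+ N)%:E * (\sum_(i <- iota 0 N.+1) \sum_(e <- wcomp (size k) (N - i))
      (g (c + i)%N a)%:E * chain g (k \oplus e) (fun=> 1) a)).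
  apply: eq_eseriesr => a /(leq_ltn_trans (leq0n _)) a0.
  rewrite IHk -fE// nneseriesZr//; last first.
    by rewrite nneseries_ge0// => i _ _; rewrite mule_ge0 ?lee_fin ?exprn_ge0.
  under eq_eseriesr => i _.
    rewrite -nneseriesZl; last first.
      by move=> j _; rewrite mule_ge0 ?lee_fin ?exprn_ge0.
    over.
  rewrite nneseries_Cauchy; last first.
    by move=> i j; rewrite !mule_ge0 ?lee_fin ?exprn_ge0.
  apply: eq_eseriesr => N _; rewrite ge0_sume_distrr; last first.
    by move=> i _; rewrite sume_ge0// => j _; rewrite mule_ge0 ?lee_fin.
  rewrite !big_seq; apply: eq_bigr => i; rewrite mem_iota add0n ltnS => /= iN.
  rewrite muleA -EFinM mulrAC -exprD subnKC// EFinM -muleA.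
  by rewrite ge0_sume_distrr.
rewrite nneseries_interchange; last first.
  move=> a N; rewrite mule_ge0 ?lee_fin ?exprn_ge0// sume_ge0// => i _.
  by rewrite sume_ge0// => e _; rewrite mule_ge0 ?lee_fin.
apply: eq_eseriesr => N _; rewrite nneseriesZl; last first.
  move=> a _; rewrite sume_ge0// => i _.
  by rewrite sume_ge0// => e _; rewrite mule_ge0 ?lee_fin.
congr (_ * _); rewrite wcompS big_allpairs_dep.
rewrite -[LHS]ereal_series nneseries_sum; last first.
  by move=> i a _; rewrite sume_ge0// => e _; rewrite mule_ge0 ?lee_fin.
apply: eq_bigr => i _; rewrite nneseries_sum; last first.
  by move=> e a _; rewrite mule_ge0 ?lee_fin.
by apply: eq_bigr => e _; rewrite ereal_series.
Qed.

Lemma nneseries_shift (u : nat -> \bar R) : (forall i, 0 <= u i) ->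
  \sum_(0 <= i <oo) u i = u 0%N + \sum_(0 <= i <oo) u i.+1.
Proof.
move=> u0; rewrite nneseries_recl//; congr (_ + _).
rewrite -[LHS](@nneseries_addn _ _ 1)//.
by apply: eq_eseriesr => i _; rewrite addn1.
Qed.

Lemma powser_fin_coef (a : nat -> \bar R) (x : R) : (0 < x)%R ->
  (forall i, 0 <= a i) -> \sum_(0 <= i <oo) (x ^+ i)%:E * a i < +oo ->
  forall i, a i \is a fin_num.
Proof.
move=> x0 a0 fin i; rewrite ge0_fin_numE// ltey; apply/eqP => aiE.
have : (x ^+ i)%:E * a i <= \sum_(0 <= i <oo) (x ^+ i)%:E * a i.
  rewrite [leRHS](@nneseriesD1 _ _ i)//= ?leeDl ?nneseries_ge0// => *;
    by rewrite mule_ge0 ?lee_fin ?exprn_ge0 ?(ltW x0).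
rewrite aiE gt0_muley ?lte_fin ?exprn_gt0// leye_eq => /eqP E.
by rewrite E in fin.
Qed.

(* Comparing the values at small [x] bounds [a 0 - b 0] by a multiple of [x];
   the induction then divides both series by [x]. *)
Lemma powser_le0 (a b : nat -> \bar R) (d : R) : (0 < d)%R ->
  (forall i, 0 <= a i) -> (forall i, 0 <= b i) ->
  (forall x, (0 < x <= d)%R -> \sum_(0 <= i <oo) (x ^+ i)%:E * a i =
                               \sum_(0 <= i <oo) (x ^+ i)%:E * b i) ->
  \sum_(0 <= i <oo) (d ^+ i)%:E * b i < +oo -> a 0%N <= b 0%N.
Proof.
move=> d0 a0 b0 ab fin.
have xe0 (x : R) (c : nat -> \bar R) i : (0 < x)%R -> (forall j, 0 <= c j) ->
    0 <= (x ^+ i)%:E * c i.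
  by move=> x0 c0; rewrite mule_ge0 ?lee_fin ?exprn_ge0 ?(ltW x0).
have := fin; rewrite nneseries_shift => [|i]; last exact: xe0.
have -> : \sum_(0 <= i <oo) (d ^+ i.+1)%:E * b i.+1 =
    d%:E * \sum_(0 <= i <oo) (d ^+ i)%:E * b i.+1.
  rewrite -nneseriesZl => [|i _]; last by apply: (xe0 d (fun i => b i.+1)).
  by apply: eq_eseriesr => i _; rewrite exprS EFinM muleA.
set B := \sum_(0 <= i <oo) _.
have B0 : 0 <= B by apply: nneseries_ge0 => i _ _; apply: (xe0 d (fun i => b i.+1)).
have bfin := powser_fin_coef d0 b0 fin.
move=> Bfin; have {Bfin} : B \is a fin_num.
  rewrite ge0_fin_numE// ltey; apply/eqP => BE; move: Bfin.
  by rewrite BE gt0_muley ?lte_fin// addey ?ltxx// expr0 mul1e; case: (b 0%N) (bfin 0%N).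
move=> /fineK BE.
have key x : (0 < x <= d)%R -> a 0%N <= b 0%N + (x * fine B)%:E.
  move=> /andP[x0 xd].
  apply: (@le_trans _ _ (\sum_(0 <= i <oo) (x ^+ i)%:E * a i)).
    rewrite nneseries_shift => [|i]; last exact: xe0.
    rewrite expr0 mul1e leeDl// nneseries_ge0// => i _ _.
    by rewrite mule_ge0 ?lee_fin ?exprn_ge0 ?(ltW x0).
  rewrite ab ?x0// nneseries_shift => [|i]; last exact: xe0.
  rewrite expr0 mul1e leeD2l// EFinM BE /B -nneseriesZl => [|i _]; last first.
    by apply: (xe0 d (fun i => b i.+1)).
  apply: lee_nneseries => i *; first exact: (xe0 x b i.+1).
  rewrite exprS EFinM -muleA lee_wpmul2l ?lee_fin ?(ltW x0)//.
  by rewrite lee_wpmul2r// lee_fin lerXn2r ?nnegrE ?(ltW x0) ?(ltW d0).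
have B0' : (0 <= fine B)%R by rewrite fine_ge0.
apply/lee_addgt0Pr => e e0.
(* Small enough that x B <= e; the added 1 keeps the denominator positive when B = 0. *)
pose x := (Num.min d (e / (fine B + 1)))%R.
have x0 : (0 < x)%R by rewrite lt_min d0 divr_gt0// ltr_wpDl.
apply: (le_trans (key x _)); first by rewrite x0 ge_min lexx.
rewrite leeD2l// lee_fin.
apply: (@le_trans _ _ ((e / (fine B + 1)) * fine B)%R).
  by rewrite ler_wpM2r// ge_min lexx orbT.
rewrite mulrAC ler_pdivrMr ?ltr_wpDl// ler_pM2l// lerDl.
exact: ler01.
Qed.

Lemma powser_eq (a b : nat -> \bar R) (d : R) : (0 < d)%R ->
  (forall i, 0 <= a i) -> (forall i, 0 <= b i) ->
  (forall x, (0 < x <= d)%R -> \sum_(0 <= i <oo) (x ^+ i)%:E * a i =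
                               \sum_(0 <= i <oo) (x ^+ i)%:E * b i) ->
  \sum_(0 <= i <oo) (d ^+ i)%:E * b i < +oo -> forall i, a i = b i.
Proof.
move=> d0 a0 b0 ab fin i; elim: i a b a0 b0 ab fin => [|i IHi] a b a0 b0 ab fin.
  apply/eqP; rewrite eq_le (powser_le0 d0 a0 b0 ab fin)/=.
  by apply: (powser_le0 d0 b0 a0) => [x xd|]; rewrite ab// lexx d0.
have finb := powser_fin_coef d0 b0 fin.
have ab0 : a 0%N = b 0%N.
  apply/eqP; rewrite eq_le (powser_le0 d0 a0 b0 ab fin)/=.
  by apply: (powser_le0 d0 b0 a0) => [x xd|]; rewrite ab// lexx d0.
have xe0 (x : R) (c : nat -> \bar R) j : (0 < x)%R -> (forall j, 0 <= c j) ->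
    0 <= (x ^+ j)%:E * c j.
  by move=> x0 c0; rewrite mule_ge0 ?lee_fin ?exprn_ge0 ?(ltW x0).
have shift (x : R) (c : nat -> \bar R) : (0 < x)%R -> (forall j, 0 <= c j) ->
    \sum_(0 <= j <oo) (x ^+ j)%:E * c j =
    c 0%N + x%:E * \sum_(0 <= j <oo) (x ^+ j)%:E * c j.+1.
  move=> x0 c0; rewrite nneseries_shift => [|j]; last exact: xe0.
  rewrite expr0 mul1e -nneseriesZl => [|j _]; last exact: (xe0 x (fun j => c j.+1)).
  by congr (_ + _); apply: eq_eseriesr => j _; rewrite exprS EFinM muleA.
apply: (IHi (fun j => a j.+1) (fun j => b j.+1)) => // [x xd|].
  have /andP[x0 _] := xd; have := ab x xd; rewrite (shift x a)// (shift x b)// ab0.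
  (* The common constant term cancels in the extended reals because it is finite; multiplying by 1/x
     then leaves the shifted series. *)
  move: (finb 0%N) => fb0 E; have {}E := congr1 (fun t => t - b 0%N) E.
  move: E; rewrite ![b 0%N + _]addeC !addeK// => E.
  have := congr1 (fun t => (x^-1)%:E * t) E.
  by rewrite !muleA -!EFinM mulVf ?gt_eqF// !mul1e.
move: fin; rewrite (shift d b)// => fin; rewrite ltey; apply/eqP => BE; move: fin.
by rewrite BE gt0_muley ?lte_fin// addey ?ltxx//; case: (b 0%N) (finb 0%N).
Qed.

End PowerSeries.

(** * The connectors *)

Section Telescope.
Local Open Scope ereal_scope.
Context {R : realType}.

Lemma nneseries_telescope (u : nat -> R) m : nonincreasing_seq u ->
  (u @ \oo --> (0 : R))%R ->
  \sum_(0 <= a <oo | (m < a)%N) (u a.-1 - u a)%:E = (u m)%:E.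
Proof.
move=> u_dec u_cvg; rewrite -ereal_series -(@nneseries_addn _ _ m.+1); last first.
  by move=> i; rewrite lee_fin subr_ge0 u_dec// leq_pred.
apply/cvg_lim => //.
have -> : (fun N => \sum_(0 <= i < N) (u (i + m.+1).-1 - u (i + m.+1)%N)%:E) =
    (fun N => (u m - u (N + m)%N)%:E).
  apply/funext; elim=> [|N IHN]; first by rewrite big_geq// add0n subrr.
  rewrite big_nat_recr//= IHN -EFinD addnS addSn/=; congr EFin; ring.
apply: cvg_EFin; first by apply: nearW.
rewrite -[X in _ --> X](subr0 (u m)); apply: cvgB; first exact: cvg_cst.
by rewrite (@cvg_shiftn _ _ u).
Qed.

(** Both sides are the sum over a > m and b > n of w(a) w(b) G(a, b), taken in the two orders. Both
    connectors cross the entry 2 in this way. *)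
Lemma double_tail_sym (w : nat -> R) (G H : nat -> nat -> R) :
  (forall a, (0 <= w a)%R) -> (forall a b, (0 <= G a b)%R) ->
  (forall a b, G a b = G b a) ->
  (forall a n, (0 < a)%N ->
    \sum_(0 <= b <oo | (n < b)%N) (w b * G a b)%:E = (H a n)%:E) ->
  forall m n, \sum_(0 <= a <oo | (m < a)%N) (w a)%:E * (H a n)%:E =
              \sum_(0 <= b <oo | (n < b)%N) (w b)%:E * (H b m)%:E.
Proof.
move=> w0 G0 GC GH m n.
have wG0 a b : (0 <= w b * G a b)%R by rewrite mulr_ge0.
have E p q : \sum_(0 <= a <oo | (p < a)%N) (w a)%:E * (H a q)%:E =
    \sum_(0 <= a <oo | (p < a)%N) \sum_(0 <= b <oo | (q < b)%N)
      (w a * (w b * G a b))%:E.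
  apply: eq_eseriesr => a /(leq_ltn_trans (leq0n _)) a0.
  rewrite -GH// -nneseriesZl => [|b _]; last by rewrite lee_fin.
  by apply: eq_eseriesr => b _; rewrite EFinM.
rewrite !E nneseries_interchange => [|a b]; last by rewrite lee_fin mulr_ge0.
apply: eq_eseriesr => b _; apply: eq_eseriesr => a _.
by rewrite GC mulrCA.
Qed.

End Telescope.

(** * The connectors C and D for fixed x and y *)

Section Connector.
Context {R : realType}.
Variables x y : R.
Hypothesis xyP : [/\ 0 < x, 4 * x <= 1, 0 < y & 4 * y <= 1].

Definition conP (n : nat) : R := (n%:R - x) * (n%:R - y).

(** In rising factorials, (1 - x)_m (1 - y)_m / m!. *)
Definition cfact (m : nat) : R := \prod_(i < m) (conP i.+1 / i.+1%:R).

Definition cpoch (m : nat) : R := \prod_(i < m) (i.+1%:R - (x + y)).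

(** A deformation of m! n! / (m + n)!, its value at x = y = 0, which is the classical connector for
    the duality of multiple zeta values. *)
Definition conD (m n : nat) : R := cfact m * cfact n / cpoch (m + n).

Lemma conP_gt0 n : 0 < conP n.+1.
Proof.
have [x0 x4 y0 y4] := xyP.
have n0 : 0 <= n%:R :> R by [].
by rewrite /conP -natr1 mulr_gt0//; lra.
Qed.

Let s_gt0 n : 0 < n.+1%:R - (x + y).
Proof.
have [x0 x4 y0 y4] := xyP.
by have n0 : 0 <= n%:R :> R by []; rewrite -natr1; lra.
Qed.

Let cfact_gt0 m : 0 < cfact m.
Proof. by apply: prodr_gt0 => i _; rewrite divr_gt0 ?conP_gt0. Qed.

Let cpoch_gt0 m : 0 < cpoch m.
Proof. by apply: prodr_gt0 => i _; apply: s_gt0. Qed.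

Lemma conD_gt0 m n : 0 < conD m n.
Proof. by rewrite divr_gt0 ?mulr_gt0. Qed.

Lemma conD_ge0 m n : 0 <= conD m n.
Proof. by rewrite ltW ?conD_gt0. Qed.

Lemma conDC m n : conD m n = conD n m.
Proof. by rewrite /conD addnC [cfact m * _]mulrC. Qed.

Lemma conDSr m n :
  conD m n.+1 = conP n.+1 / n.+1%:R / ((m + n).+1%:R - (x + y)) * conD m n.
Proof.
rewrite /conD addnS /cfact /cpoch !big_ord_recr /= -/(cpoch _).
have := cpoch_gt0 (m + n); have := s_gt0 (m + n).
rewrite /cpoch; set A := \prod_(i < m + n) _; set B := _ - (x + y).
move=> /lt0r_neq0 B0 /lt0r_neq0 A0; have : n.+1%:R != 0 :> R by [].
by move: (n.+1%:R) => N N0; field; rewrite A0 B0 N0.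
Qed.

(** With N = n + 1 the factor m N - x y is symmetric in m and N, as [double_tail_sym] demands. *)
Lemma conD_diff m n :
  conP n.+1 * (conD m n - conD m n.+1) = (m%:R * n.+1%:R - x * y) * conD m n.+1.
Proof.
rewrite conDSr; have := s_gt0 (m + n); have := conP_gt0 n.
move=> /lt0r_neq0 p0 /lt0r_neq0 B0; have n0 : n.+1%:R != 0 :> R by [].
move: n0 p0 B0; rewrite /conP -addnS natrD.
by move: (n.+1%:R) (m%:R) => N M n0 p0 B0; field; rewrite B0 n0.
Qed.

Lemma conD_row0 m :
  conD m.+1 0 = (1 + x * y / (m.+1%:R * (m.+1%:R - (x + y)))) * conD m 0.
Proof.
rewrite conDC conDSr conDC add0n; congr (_ * _).
have := s_gt0 m => /lt0r_neq0 B0; have n0 : m.+1%:R != 0 :> R by [].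
by move: n0 B0; rewrite /conP; move: (m.+1%:R) => N n0 B0; field; rewrite B0 n0.
Qed.

Lemma conD_row0_nondecreasing : nondecreasing_seq (conD^~ 0%N).
Proof.
have [x0 x4 y0 y4] := xyP.
apply/nondecreasing_seqP => m; rewrite conD_row0 ler_peMl ?(ltW (conD_gt0 _ _))//.
by rewrite lerDl divr_ge0 ?mulr_ge0 ?(ltW (s_gt0 _)) ?(ltW x0) ?(ltW y0).
Qed.

Lemma conD_row0_le m : conD m 0 <= 2 - m.+1%:R^-1.
Proof.
have [x0 x4 y0 y4] := xyP.
elim: m => [|m IHm].
  by rewrite /conD /cfact /cpoch !big_ord0; lra.
rewrite conD_row0; set u := _ / _.
have u0 : 0 <= u.
  by rewrite divr_ge0 ?mulr_ge0 ?(ltW (s_gt0 _)) ?(ltW x0) ?(ltW y0).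
apply: (@le_trans _ _ ((1 + u) * (2 - m.+1%:R^-1))); first by rewrite ler_wpM2l ?addr_ge0.
have m1 : 1 <= m.+1%:R :> R by rewrite ler1n.
(* The row stays below 2, so a step adds at most 2 u <= 1/(m + 1) - 1/(m + 2), exactly the growth of
   the bound. *)
have u1 : u <= (2 * (m.+1%:R * m.+2%:R))^-1.
  rewrite /u ler_pdivrMr ?mulr_gt0// [leRHS]mulrC ler_pdivlMr ?mulr_gt0//.
  have xy : 16 * (x * y) <= 1 by nra.
  rewrite -[m.+2%:R]natr1; move: (m.+1%:R) m1 => N N1.
  have h1 : 16 * (x * y) * (N * (N + 1)) <= 1 * (N * (N + 1)).
    by rewrite ler_wpM2r// mulr_ge0//; lra.
  have h2 : N * (4 * x) <= N * 1 by rewrite ler_wpM2l//; lra.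
  have h3 : N * (4 * y) <= N * 1 by rewrite ler_wpM2l//; lra.
  nra.
have m2 : m.+2%:R^-1 = m.+1%:R^-1 - (m.+1%:R * m.+2%:R)^-1 :> R.
  by rewrite -[m.+2%:R]natr1; field; rewrite !lt0r_neq0//; lra.
move: u1; rewrite m2 invfM.
have a0 : 0 <= m.+1%:R^-1 :> R by [].
move: (m.+1%:R^-1 : R) a0 ((m.+1%:R * m.+2%:R)^-1 : R) => a a0 b.
rewrite mulrC ler_pdivlMr// => u1; have := mulr_ge0 u0 a0.
nra.
Qed.

(** Classically Gamma(1 - x - y) / (Gamma(1 - x) Gamma(1 - y)); only its positivity matters, since
    it is cancelled in the end. *)
Definition conK : R := limn (conD^~ 0%N).

Lemma conD_row0_cvg : conD m 0 @[m --> \oo] --> conK.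
Proof.
apply: nondecreasing_is_cvgn; first exact: conD_row0_nondecreasing.
exists 2 => _ [m _ <-]; apply: le_trans (conD_row0_le m) _.
by rewrite gerBl.
Qed.

Lemma conK_gt0 : 0 < conK.
Proof.
apply: lt_le_trans (conD_gt0 0 0) _.
apply: (nondecreasing_cvgn_le conD_row0_nondecreasing).
by apply/cvg_ex; exists conK; exact: conD_row0_cvg.
Qed.

(* For 0 < n this is the tail over a > m of the series of a n D(a, n) / P(a), by
   [conC_cvg]; the finite sum also covers n = 0, where that series vanishes. *)
Definition conC (m n : nat) : R :=
  conK - \sum_(i < m) i.+1%:R * n%:R * conD i.+1 n / conP i.+1.

Lemma conC0n n : conC 0 n = conK.
Proof. by rewrite /conC big_ord0 subr0. Qed.

Lemma conCn0 n : conC n 0 = conK.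
Proof. by rewrite /conC big1 ?subr0// => i _; rewrite mulr0 !mul0r. Qed.

Lemma conC_diffl m n :
  conC m n - conC m.+1 n = m.+1%:R * n%:R * conD m.+1 n / conP m.+1.
Proof. by rewrite /conC big_ord_recr /=; ring. Qed.

(** The mirror image of [conC_diffl], by induction on m around a unit square. Once the values of D
    are expressed by D(m + 1, n + 1), it reduces to P(n + 1) - P(m + 1) = (n - m)(m + n + 2 - x -
    y). *)
Lemma conC_diffr m n :
  conC m n - conC m n.+1 = m%:R * n.+1%:R * conD m n.+1 / conP n.+1.
Proof.
elim: m => [|m IHm]; first by rewrite !conC0n subrr !mul0r.
have -> : conC m.+1 n - conC m.+1 n.+1 =
  (conC m n - conC m n.+1) - (conC m n - conC m.+1 n) +
  (conC m n.+1 - conC m.+1 n.+1) by ring.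
rewrite IHm !conC_diffl.
have p0 := lt0r_neq0 (conP_gt0 n); have q0 := lt0r_neq0 (conP_gt0 m).
pose T : R := n.+1%:R + m.+1%:R - (x + y).
have T0 : T != 0 by rewrite /T -natrD addnS lt0r_neq0.
have N0 : n.+1%:R != 0 :> R by [].
have M0 : m.+1%:R != 0 :> R by [].
have d1 : conD m.+1 n = n.+1%:R * T / conP n.+1 * conD m.+1 n.+1.
  have -> : T = (m.+1 + n).+1%:R - (x + y) by rewrite -addnS addnC natrD.
  rewrite conDSr; have := lt0r_neq0 (s_gt0 (m.+1 + n)).
  by move: (_ - _) (n.+1%:R : R) N0 => U N N0 U0; field; rewrite p0 U0 N0.
have d2 : conD m n.+1 = m.+1%:R * T / conP m.+1 * conD m.+1 n.+1.
  have -> : T = (n.+1 + m).+1%:R - (x + y) by rewrite -addnS natrD.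
  rewrite conDC [conD m.+1 _]conDC conDSr; have := lt0r_neq0 (s_gt0 (n.+1 + m)).
  by move: (_ - _) (m.+1%:R : R) M0 => U M M0 U0; field; rewrite q0 U0 M0.
have pq : conP n.+1 - conP m.+1 = (n.+1%:R - m.+1%:R) * T by rewrite /conP /T; ring.
rewrite d1 d2; apply/eqP; rewrite -subr_eq0; apply/eqP.
transitivity (m.+1%:R * n.+1%:R * conD m.+1 n.+1 / (conP m.+1 * conP n.+1) *
  ((m%:R - n%:R) * T + (conP n.+1 - conP m.+1))).
  by field; rewrite p0 q0.
by rewrite pq -[m.+1%:R]natr1 -[n.+1%:R]natr1; ring.
Qed.

(** C takes the same constant value on both axes, and its differences in the two directions are
    mirror images. *)
Lemma conC_sym m n : conC m n = conC n m.
Proof.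
elim: m => [|m IHm] in n *; first by rewrite conC0n conCn0.
apply: (@subrI _ (conC m n)).
rewrite conC_diffl IHm conC_diffr conDC; congr (_ / _); ring.
Qed.

Let inv_cvg0 n : ((m + n).+1%:R - (x + y))^-1 @[m --> \oo] --> 0.
Proof.
have [x0 x4 y0 y4] := xyP.
apply: (@squeeze_cvgr _ _ _ _ (fun=> 0) (fun m => 2 * harmonic m)); last 2 first.
- exact: cvg_cst.
- by rewrite -[X in _ --> X](mulr0 2); apply: cvgMr; exact: cvg_harmonic.
near=> m; rewrite invr_ge0 (ltW (s_gt0 _)) /= /harmonic /=.
rewrite -[leLHS]mul1r ler_pdivrMr// mulrAC ler_pdivlMr// mul1r.
rewrite -addSn natrD.
have m1 : 1 <= m.+1%:R :> R by rewrite ler1n.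
have n0 : 0 <= n%:R :> R by [].
by lra.
Unshelve. all: by end_near. Qed.

Let conD_cvgr n : conD m n @[m --> \oo] --> if n == 0%N then conK else 0.
Proof.
elim: n => [|n IHn]; first exact: conD_row0_cvg.
rewrite /=; under eq_fun do rewrite conDSr.
have -> : 0 = conP n.+1 / n.+1%:R * 0 * (if n == 0%N then conK else 0) by ring.
by apply: cvgM => //; apply: cvgMr; exact: inv_cvg0.
Qed.

Lemma conD_cvg m : conD^~ m.+1 @ \oo --> 0.
Proof. exact: (@conD_cvgr m.+1). Qed.

Lemma natr_conD_cvg n :
  m%:R * conD m n.+1 @[m --> \oo] --> if n == 0%N then conP 1 * conK else 0.
Proof.
(* The quotient m / (m + n + 1 - (x + y)) is written as 1 minus a term tending to 0. *)
have E m : m%:R * conD m n.+1 = conP n.+1 / n.+1%:R *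
    (1 - (n.+1%:R - (x + y)) * ((m + n).+1%:R - (x + y))^-1) * conD m n.
  rewrite conDSr -addnS natrD; have := lt0r_neq0 (s_gt0 (m + n)).
  rewrite -addnS natrD; have : n.+1%:R != 0 :> R by [].
  by move: (n.+1%:R) => N N0 T0; field; rewrite N0 T0.
under eq_fun do rewrite E.
have -> : (if n == 0%N then conP 1 * conK else 0) =
    conP n.+1 / n.+1%:R * (1 - (n.+1%:R - (x + y)) * 0) *
    (if n == 0%N then conK else 0).
  by case: n {E} => [|n] /=; rewrite ?mulr0 ?subr0 ?mulr1 ?divr1.
apply: cvgM; last exact: conD_cvgr.
apply: cvgMr; apply: cvgB; first exact: cvg_cst.
by apply: cvgMr; exact: inv_cvg0.
Qed.

(** C(m, 1) tends to K - K = 0, because m D(m, 1) / P(1) tends to K; for larger n the difference of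
    neighbouring rows vanishes in the limit. *)
Lemma conC_cvg n : conC^~ n.+1 @ \oo --> 0.
Proof.
have E m k : conC m k.+1 = conC m k - k.+1%:R / conP k.+1 * (m%:R * conD m k.+1).
  by apply/eqP; rewrite eq_sym subr_eq addrC -subr_eq conC_diffr; apply/eqP; ring.
have cv k : (k.+1%:R / conP k.+1 * (m%:R * conD m k.+1)) @[m --> \oo] -->
    k.+1%:R / conP k.+1 * (if k == 0%N then conP 1 * conK else 0).
  by apply: cvgMr; exact: natr_conD_cvg.
elim: n => [|n IHn]; under eq_fun do rewrite E.
  have -> : 0 = conK - 1%:R / conP 1 * (conP 1 * conK).
    by have := lt0r_neq0 (conP_gt0 0) => p0; field.
  apply: cvgB; last exact: cv.
  by under eq_fun do rewrite conCn0; exact: cvg_cst.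
have -> : 0 = 0 - n.+2%:R / conP n.+2 * 0 :> R by ring.
by apply: cvgB => //; exact: cv.
Qed.

Lemma conC_ge0 m n : 0 <= conC m n.
Proof.
case: n => [|n]; first by rewrite conCn0 ltW ?conK_gt0.
have C_dec : nonincreasing_seq (conC^~ n.+1).
  apply/nonincreasing_seqP => i; rewrite -subr_ge0 conC_diffl.
  by rewrite divr_ge0 ?(ltW (conP_gt0 _))// (mulr_ge0 _ (conD_ge0 _ _))// mulr_ge0.
have := conC_cvg n => cv; rewrite -(cvg_lim _ cv)//.
by apply: nonincreasing_cvgn_ge => //; apply/cvg_ex; exists 0.
Qed.

(** The terms are the differences of C(a, n) / n in a, which tends to 0. *)
Lemma conD_tail m n : (0 < n)%N ->
  (\sum_(0 <= a <oo | (m < a)%N) (a%:R / conP a)%:E * (conD a n)%:E =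
   (conC m n / n%:R)%:E)%E.
Proof.
case: n => [//|n] _.
rewrite -(@nneseries_telescope _ (fun m => conC m n.+1 / n.+1%:R) m).
- apply: eq_eseriesr => -[//|a] _ /=.
  rewrite -EFinM -mulrBl conC_diffl; congr EFin.
  have := lt0r_neq0 (conP_gt0 a); have : n.+1%:R != 0 :> R by [].
  by move: (n.+1%:R) (a.+1%:R) => N A N0 p0; field; rewrite N0 p0.
- apply/nonincreasing_seqP => i; rewrite -subr_ge0 -mulrBl conC_diffl.
  rewrite divr_ge0// divr_ge0 ?(ltW (conP_gt0 _))//.
  by rewrite (mulr_ge0 _ (conD_ge0 _ _))// mulr_ge0.
- by rewrite -[X in _ --> X](mul0r n.+1%:R^-1); apply: cvgMl; exact: conC_cvg.
Qed.

Lemma conC_transport m n :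
  (\sum_(0 <= a <oo | (m < a)%N) ((conP a)^-1)%:E * (conC a n)%:E =
   \sum_(0 <= b <oo | (n < b)%N) ((conP b)^-1)%:E * (conC m b)%:E)%E.
Proof.
have [x0 x4 y0 y4] := xyP.
have P0 a : 0 <= conP a.
  case: a => [|a]; last exact/ltW/conP_gt0.
  by rewrite /conP !sub0r mulrNN mulr_ge0 ?ltW.
(* For a > 0, C(a, n) is the tail over b > n of a b D(a, b) / P(b), by [conD_tail] and symmetry. *)
rewrite (@double_tail_sym _ _ (fun a b => a%:R * b%:R * conD a b)).
- by apply: eq_eseriesr => b _; rewrite conC_sym.
- by move=> a; rewrite invr_ge0.
- by move=> a b; rewrite (mulr_ge0 _ (conD_ge0 _ _))// mulr_ge0.
- by move=> a b; rewrite conDC [a%:R * _]mulrC.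
- move=> a k a0; rewrite -[conC a k](@divfK _ a%:R) ?pnatr_eq0 -?lt0n//.
  rewrite conC_sym mulrC EFinM -conD_tail// -nneseriesZl => [|b _]; last first.
    by rewrite mule_ge0// lee_fin ?conD_ge0// divr_ge0.
  apply: eq_eseriesr => b _; rewrite -!EFinM conDC; congr EFin; ring.
Qed.

Lemma conD_transport m n :
  (\sum_(0 <= a <oo | (m < a)%N) ((conP a)^-1)%:E * (conD a n)%:E =
   \sum_(0 <= b <oo | (n < b)%N) ((conP b)^-1)%:E * (conD m b)%:E)%E.
Proof.
have [x0 x4 y0 y4] := xyP.
have P0 a : 0 <= conP a.
  case: a => [|a]; last exact/ltW/conP_gt0.
  by rewrite /conP !sub0r mulrNN mulr_ge0 ?ltW.
have xy1 a b : 0 <= a.+1%:R * b.+1%:R - x * y.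
  have a1 : 1 <= a.+1%:R :> R by rewrite ler1n.
  have b1 : 1 <= b.+1%:R :> R by rewrite ler1n.
  by nra.
have D_diff a b : conD a.+1 b - conD a.+1 b.+1 =
    (conP b.+1)^-1 * (`|a.+1%:R * b.+1%:R - x * y| * conD a.+1 b.+1).
  have p0 := lt0r_neq0 (conP_gt0 b).
  by rewrite ger0_norm// -conD_diff mulrA mulVf// mul1r.
(* The absolute value only changes the sign on the axes, where a b - x y is negative; it makes the
   kernel nonnegative everywhere. *)
rewrite (@double_tail_sym _ _ (fun a b => `|a%:R * b%:R - x * y| * conD a b)).
- by apply: eq_eseriesr => b _; rewrite conDC.
- by move=> a; rewrite invr_ge0.
- by move=> a b; rewrite (mulr_ge0 _ (conD_ge0 _ _)).
- by move=> a b; rewrite conDC [a%:R * _]mulrC.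
- case=> [//|a] k _; rewrite -(@nneseries_telescope _ (conD a.+1) k).
  + by apply: eq_eseriesr => -[//|b] _ /=; rewrite D_diff.
  + apply/nonincreasing_seqP => i; rewrite -subr_ge0 D_diff.
    by rewrite (mulr_ge0 _ (mulr_ge0 _ (conD_ge0 _ _)))// invr_ge0.
  + rewrite (_ : conD a.+1 = conD^~ a.+1); first exact: conD_cvg.
    by apply/funext => i; rewrite conDC.
Qed.

End Connector.

(** * Words and transport *)

(* [None] stands for the index (2), [Some p] for (1, {2}^p, 3); both are
   self-dual, so that duality reverses a list of atoms. *)
Definition atom (o : option nat) : seq nat :=
  if o is Some p then 1%N :: nseq p 2%N ++ [:: 3%N] else [:: 2%N].

Definition word (s : seq (option nat)) : seq nat := flatten (map atom s).

(** The 1 shares a block with the entry after it, which is the 3 when p = 0; hence the separate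
    case. Each list is fixed by reversing it and swapping its pairs. *)
Definition atom_blocks (o : option nat) : seq (nat * nat) :=
  match o with
  | None => [:: (1, 1)]
  | Some 0 => [:: (2, 2)]
  | Some p.+1 => (2, 1) :: nseq p (1, 1) ++ [:: (1, 2)]
  end%N.

Lemma word_cat s t : word (s ++ t) = word s ++ word t.
Proof. by rewrite /word map_cat flatten_cat. Qed.

Lemma word1 o : word [:: o] = atom o.
Proof. exact: cats0. Qed.

Lemma of_blocks_cat s t : of_blocks (s ++ t) = of_blocks s ++ of_blocks t.
Proof. by rewrite /of_blocks map_cat flatten_cat. Qed.

Lemma of_blocks_atom o : of_blocks (atom_blocks o) = atom o.
Proof.
case: o => [[|p]|] //=; rewrite -cat1s of_blocks_cat /=; congr [:: _, _ & _].
rewrite of_blocks_cat; congr (_ ++ _).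
by elim: p => //= p IHp; congr (_ :: _).
Qed.

Lemma of_blocks_word s : of_blocks (flatten (map atom_blocks s)) = word s.
Proof. by elim: s => //= o s IHs; rewrite of_blocks_cat IHs of_blocks_atom. Qed.

Lemma pos_blocks_word s : pos_blocks (flatten (map atom_blocks s)).
Proof.
rewrite /pos_blocks; elim: s => //= o s IHs; rewrite all_cat IHs andbT.
by case: o => [[|p]|] //=; rewrite all_cat all_nseq orbT.
Qed.

Lemma rev_swap_atom_blocks o :
  rev [seq (p.2, p.1) | p <- atom_blocks o] = atom_blocks o.
Proof.
case: o => [[|p]|] //=; rewrite map_cat map_nseq /= -cat1s rev_cat rev_cat /=.
by rewrite rev_nseq.
Qed.

Lemma dual_word s : dual (word s) = word (rev s).
Proof.
rewrite /dual -of_blocks_word of_blocksK ?pos_blocks_word//.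
rewrite -[RHS]of_blocks_word; congr of_blocks.
elim: s => //= o s IHs; rewrite map_cat rev_cat IHs rev_swap_atom_blocks.
by rewrite rev_cons map_rcons flatten_rcons.
Qed.

Lemma index_213_word (d : nat) (n : (2 * d).+1.-tuple nat) :
  exists s, index_213 n = word s.
Proof.
have N2 q : nseq q 2%N = word (nseq q None) by elim: q => //= q ->.
rewrite /index_213 N2.
exists (nseq (nth 0 n 0)%N None ++ flatten
  [seq Some (nth 0 n (2 * i + 1))%N :: nseq (nth 0 n (2 * i + 2))%N None
     | i <- iota 0 d]).
rewrite word_cat; congr (_ ++ _); elim: (iota 0 d) => //= i t ->.
set u := flatten _; rewrite -[Some _ :: _]cat1s !word_cat -N2 /word /= cats0.
by rewrite -!catA.
Qed.

(** * Transport of words across the connectors *)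

Section Transport.
Local Open Scope ereal_scope.
Context {R : realType}.
Variables (wt : nat -> nat -> R) (C D : nat -> nat -> R).
Hypotheses (wt0 : forall c a, (0 <= wt c a)%R).
Hypotheses (C0 : forall m n, (0 <= C m n)%R) (D0 : forall m n, (0 <= D m n)%R).
Hypotheses (CC : forall m n, C m n = C n m) (DC : forall m n, D m n = D n m).
Hypothesis wt3 : forall a, (0 < a)%N -> wt 3 a = (wt 2 a / a%:R)%R.
Hypothesis C_tail : forall m n,
  \sum_(0 <= a <oo | (m < a)%N) (wt 2 a)%:E * (C a n)%:E =
  \sum_(0 <= b <oo | (n < b)%N) (wt 2 b)%:E * (C m b)%:E.
Hypothesis D_tail : forall m n,
  \sum_(0 <= a <oo | (m < a)%N) (wt 2 a)%:E * (D a n)%:E =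
  \sum_(0 <= b <oo | (n < b)%N) (wt 2 b)%:E * (D m b)%:E.
Hypothesis DC_tail : forall m n, (0 < n)%N ->
  \sum_(0 <= a <oo | (m < a)%N) (wt 1 a)%:E * (D a n)%:E = (C m n / n%:R)%:E.

(** [L] acts on the first variable of a kernel and [S] on the second. *)
Let L k (H : nat -> nat -> \bar R) m n := chain wt k (H^~ n) m.
Let S k (H : nat -> nat -> \bar R) m n := chain wt k (H m) n.
Let C' m n := (C m n)%:E.
Let D' m n := (D m n)%:E.

Let L_cat k l H : L (k ++ l) H = L k (L l H).
Proof. by apply/funext => m; apply/funext => n; rewrite /L chain_cat. Qed.

Let S_cat k l H : S (k ++ l) H = S k (S l H).
Proof. by apply/funext => m; apply/funext => n; rewrite /S chain_cat. Qed.

Let LS k l H : (forall m n, 0 <= H m n) -> L k (S l H) = S l (L k H).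
Proof.
move=> H0; apply/funext => m; apply/funext => n.
exact: (@chain_interchange R wt k l H wt0 H0).
Qed.

Let C'0 m n : 0 <= C' m n. Proof. by rewrite lee_fin. Qed.
Let D'0 m n : 0 <= D' m n. Proof. by rewrite lee_fin. Qed.

Let L2C : L [:: 2%N] C' = S [:: 2%N] C'.
Proof. by apply/funext => m; apply/funext => n; exact: C_tail. Qed.

Let L2D : L [:: 2%N] D' = S [:: 2%N] D'.
Proof. by apply/funext => m; apply/funext => n; exact: D_tail. Qed.

Let L2sD p : L (nseq p 2%N) D' = S (nseq p 2%N) D'.
Proof.
elim: p => [//|p IHp].
have -> : nseq p.+1 2%N = nseq p 2%N ++ [:: 2%N] by elim: p {IHp} => //= p ->.
rewrite L_cat L2D LS// IHp -S_cat.
by have -> : [:: 2%N] ++ nseq p 2%N = nseq p 2%N ++ [:: 2%N] by elim: p {IHp} => //= p ->.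
Qed.

(** The weight of 3 is that of 2 divided by a, and C(a, n) / a is a tail of D in the other
    variable. *)
Let L3C : L [:: 3%N] C' = L [:: 2%N] (S [:: 1%N] D').
Proof.
apply/funext => m; apply/funext => n; apply: eq_eseriesr => a.
move=> /(leq_ltn_trans (leq0n _)) a0.
have E : S [:: 1%N] D' a n = (C a n / a%:R)%:E.
  by rewrite CC -DC_tail//; apply: eq_eseriesr => b _; rewrite [D b a]DC.
rewrite -[X in _ = _ * X]/(S [:: 1%N] D' a n) E wt3// -!EFinM.
by congr EFin; ring.
Qed.

Let S3C : S [:: 3%N] C' = S [:: 2%N] (L [:: 1%N] D').
Proof.
apply/funext => m; apply/funext => n; apply: eq_eseriesr => a.
move=> /(leq_ltn_trans (leq0n _)) a0.
have E : L [:: 1%N] D' m a = (C m a / a%:R)%:E by exact: DC_tail.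
rewrite -[X in _ = _ * X]/(L [:: 1%N] D' m a) E wt3// -!EFinM.
by congr EFin; ring.
Qed.

(* The entries 1 and 3 exchange [C] and [D]: a 3 acting on one variable of [C]
   is a 2 on the same variable and a 1 on the other variable of [D]. *)
Let atom_transport o : L (atom o) C' = S (atom o) C'.
Proof.
case: o => [p|] /=; last exact: L2C.
(* The 3 splits, turning C into D; all the 2s then cross D. The leading 1, left on the first
   variable, recombines with the innermost 2 on the second into a 3, turning D back into C. *)
rewrite -(cat1s 1%N) 2!L_cat 2!S_cat L3C LS// L2D -S_cat LS// L2sD.
have -> : L [:: 1%N] (S ([:: 1%N] ++ [:: 2%N]) (S (nseq p 2%N) D')) =
    S [:: 1%N] (S (2%N :: nseq p 2%N) (L [:: 1%N] D')).
  by rewrite -!S_cat LS.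
rewrite S3C; congr (S _ _); rewrite -S_cat.
by have -> : 2%N :: nseq p 2%N = nseq p 2%N ++ [:: 2%N] by elim: p => //= p ->.
Qed.

(** The innermost atom crosses first, and each later one lands inside those already moved; hence the
    reversal. *)
Lemma word_transport s : L (word s) C' = S (word (rev s)) C'.
Proof.
elim: s => [//|o s IHs].
rewrite rev_cons -cats1 word_cat word1 S_cat -atom_transport.
by rewrite -LS// -IHs -L_cat.
Qed.

Lemma word_transport00 s :
  chain wt (word s) (fun a => (C a 0%N)%:E) 0%N =
  chain wt (word (rev s)) (fun a => (C 0%N a)%:E) 0%N.
Proof. exact: (congr1 (fun H => H 0%N 0%N) (word_transport s)). Qed.

End Transport.

(** * Finiteness of the generating functions *)

Section Decay.
Local Open Scope ereal_scope.
Context {R : realType}.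
Variable wt : nat -> nat -> R.
Hypothesis wt0 : forall c a, (0 <= wt c a)%R.
Hypothesis wt2 : forall a, (0 < a)%N -> (wt 2 a <= 4 / (a%:R * a.+1%:R))%R.
Hypothesis wt1 : forall a, (0 < a)%N -> wt 1 a = (wt 2 a * a%:R)%R.
Hypothesis wt3 : forall a, (0 < a)%N -> wt 3 a = (wt 2 a / a%:R)%R.

Definition bounded_above (h : nat -> \bar R) :=
  exists2 M : R, (0 <= M)%R & forall m, h m <= M%:E.

(** The weight of 1 is only bounded by a multiple of 1/a, so a 1 needs this decay of its argument to
    converge. *)
Definition decaying (h : nat -> \bar R) :=
  exists2 M : R, (0 <= M)%R & forall m, h m <= (M / m.+1%:R)%:E.

Lemma decaying_bounded h : decaying h -> bounded_above h.
Proof.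
case=> M M0 hM; exists M => // m; apply: le_trans (hM m) _.
by rewrite lee_fin ler_pdivrMr// ler_peMr// ler1n.
Qed.

(** The bound M / (a (a + 1)) = M/a - M/(a + 1) telescopes to M / (m + 1). *)
Lemma decaying_tail (u : nat -> \bar R) (M : R) : (0 <= M)%R ->
  (forall a, 0 <= u a) ->
  (forall a, (0 < a)%N -> u a <= (M / (a%:R * a.+1%:R))%:E) ->
  decaying (fun m => \sum_(0 <= a <oo | (m < a)%N) u a).
Proof.
move=> M0 u0 uM; exists M => // m.
rewrite -(@nneseries_telescope _ (fun m => M / m.+1%:R)%R m).
- apply: lee_nneseries => // -[//|a] _; apply: (le_trans (uM a.+1 isT)).
  rewrite lee_fin le_eqVlt; apply/orP; left; apply/eqP => /=.
  have a0 : (a.+1%:R != 0 :> R)%R by [].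
  have a1 : (a.+1%:R + 1 != 0 :> R)%R by rewrite natr1.
  rewrite -[(a.+2%:R)%R]natr1; move: (a.+1%:R : R)%R a0 a1 => N N0 N1.
  by field; rewrite N0 N1.
- apply/nonincreasing_seqP => i.
  by rewrite ler_wpM2l// lef_pV2 ?posrE// ler_nat.
- rewrite -[X in (_ --> X)%classic](mulr0 M); apply: cvgMr.
  exact: cvg_harmonic.
Qed.

Let u_ge0 c h : (forall a, 0 <= h a) -> forall a, 0 <= (wt c a)%:E * h a.
Proof. by move=> h0 a; rewrite mule_ge0 ?lee_fin. Qed.

Lemma decaying2 h : (forall a, 0 <= h a) -> bounded_above h ->
  decaying (chain wt [:: 2%N] h).
Proof.
move=> h0 [M M0 hM]; apply: (@decaying_tail _ (4 * M)%R); rewrite ?mulr_ge0//.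
  exact: u_ge0.
move=> a a0; apply: (@le_trans _ _ ((wt 2 a)%:E * M%:E)).
  by rewrite lee_wpmul2l ?lee_fin.
by rewrite lee_fin mulrAC ler_wpM2r// wt2.
Qed.

Lemma decaying3 h : (forall a, 0 <= h a) -> bounded_above h ->
  decaying (chain wt [:: 3%N] h).
Proof.
move=> h0 [M M0 hM]; apply: (@decaying_tail _ (4 * M)%R); rewrite ?mulr_ge0//.
  exact: u_ge0.
move=> a a0; apply: (@le_trans _ _ ((wt 3 a)%:E * M%:E)).
  by rewrite lee_wpmul2l ?lee_fin.
rewrite lee_fin mulrAC ler_wpM2r//; apply: le_trans (wt2 a0).
by rewrite wt3// ler_pdivrMr ?ltr0n// ler_peMr// ler1n.
Qed.

Lemma decaying1 h : (forall a, 0 <= h a) -> decaying h ->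
  decaying (chain wt [:: 1%N] h).
Proof.
move=> h0 [M M0 hM]; apply: (@decaying_tail _ (4 * M)%R); rewrite ?mulr_ge0//.
  exact: u_ge0.
move=> a a0; apply: (@le_trans _ _ ((wt 1 a)%:E * (M / a.+1%:R)%:E)).
  by rewrite lee_wpmul2l ?lee_fin.
have aR : (0 < a%:R :> R)%R by rewrite ltr0n.
have h1 : (wt 1 a <= 4 / a.+1%:R)%R.
  rewrite wt1// -ler_pdivlMr//; apply: le_trans (wt2 a0) _.
  by rewrite invfM mulrA mulrAC.
rewrite lee_fin; apply: le_trans (ler_wpM2r _ h1) _; first by rewrite divr_ge0.
rewrite mulrACA -invfM ler_wpM2l ?mulr_ge0// lef_pV2 ?posrE ?mulr_gt0//.
by rewrite ler_wpM2r// ler_nat.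
Qed.

(** Every atom sends bounded functions to decaying ones: its last entry, 2 or 3, creates the decay,
    which further 2s and the leading 1 preserve. *)
Lemma chain_word_lty s m : chain wt (word s) (fun=> 1) m < +oo.
Proof.
suff [M M0 hM] : bounded_above (chain wt (word s) (fun=> 1)).
  by apply: le_lt_trans (hM m) _; rewrite ltry.
have ch0 k : forall a, 0 <= chain wt k (fun=> 1) a by apply: chain_ge0.
elim: s => [|o s IHs]; first by exists 1%R.
case: o => [p|]; last exact/decaying_bounded/decaying2.
rewrite -cat1s word_cat word1 chain_cat.
move: (chain wt (word s) _) (ch0 (word s)) IHs => h h0 hb.
have chh0 k : forall a, 0 <= chain wt k h a by apply: chain_ge0.
rewrite /atom -(cat1s 1%N) chain_cat; apply/decaying_bounded/decaying1 => //.
elim: p => [|p IHp]; first exact: decaying3.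
rewrite [nseq _ _]/= cat_cons -(cat1s 2%N) chain_cat.
by apply: decaying2 => //; exact: decaying_bounded.
Qed.

End Decay.

(** * Generating functions *)

Section DoubleOhno.
Context {R : realType}.

Definition wt_zeta (c a : nat) : R := a%:R ^- c.

Definition wt_ohno (y : R) (c a : nat) : R := wt_zeta c a * (1 - y / a%:R)^-1.

Definition wt_dbl (x y : R) (c a : nat) : R := wt_ohno y c a * (1 - x / a%:R)^-1.

Lemma wt_zeta_ge0 c a : 0 <= wt_zeta c a.
Proof. by rewrite invr_ge0 exprn_ge0. Qed.

Lemma geom_den_gt0 (x : R) a : x < 1 -> 0 <= x -> 0 < 1 - x / a%:R.
Proof.
(* For a = 0 the quotient x / 0 is 0, and the denominator is 1. *)
move=> x1 x0; case: a => [|a]; first by rewrite invr0 mulr0 subr0.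
rewrite subr_gt0 ltr_pdivrMr// mul1r; apply: lt_le_trans x1 _.
by rewrite ler1n.
Qed.

Lemma wt_ohno_ge0 y c a : y < 1 -> 0 <= y -> 0 <= wt_ohno y c a.
Proof.
by move=> y1 y0; rewrite mulr_ge0 ?wt_zeta_ge0// invr_ge0 ltW// geom_den_gt0.
Qed.

Lemma wt_dbl_ge0 x y c a : x < 1 -> 0 <= x -> y < 1 -> 0 <= y ->
  0 <= wt_dbl x y c a.
Proof.
by move=> *; rewrite mulr_ge0 ?wt_ohno_ge0// invr_ge0 ltW// geom_den_gt0.
Qed.

(** The free factor [t] serves both variables: it is 1 for y, and the factor already produced by y
    for x. *)
Lemma geometric_weight (x t : R) c a : x < 1 -> 0 <= x -> (0 < a)%N ->
  (\sum_(0 <= i <oo) (x ^+ i * (wt_zeta (c + i) a * t))%:E =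
   (wt_zeta c a * t * (1 - x / a%:R)^-1)%:E)%E.
Proof.
move=> x1 x0 a0; apply/cvg_lim => //.
have aR : 1 <= a%:R :> R by rewrite ler1n.
have z1 : `|x / a%:R| < 1.
  rewrite ger0_norm ?divr_ge0// ltr_pdivrMr ?mul1r; first exact: lt_le_trans aR.
  exact: lt_le_trans aR.
have := @cvg_geometric_series _ (wt_zeta c a * t) _ z1 => cv.
rewrite (_ : (fun _ => _) = EFin \o series (geometric (wt_zeta c a * t) (x / a%:R))).
  by apply: cvg_EFin => //; apply: nearW.
apply/funext => N; rewrite /= sumEFin; congr EFin; apply: eq_bigr => i _ /=.
by rewrite /wt_zeta exprD invfM expr_div_n; ring.
Qed.

Lemma wt_ohnoE y c a : y < 1 -> 0 <= y -> (0 < a)%N ->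
  (\sum_(0 <= i <oo) (y ^+ i * wt_zeta (c + i) a)%:E = (wt_ohno y c a)%:E)%E.
Proof.
move=> y1 y0 a0; have := geometric_weight 1 c y1 y0 a0; rewrite mulr1 => <-.
by apply: eq_eseriesr => i _; rewrite mulr1.
Qed.

Lemma wt_dblE x y c a : x < 1 -> 0 <= x -> (0 < a)%N ->
  (\sum_(0 <= i <oo) (x ^+ i * wt_ohno y (c + i) a)%:E = (wt_dbl x y c a)%:E)%E.
Proof. exact: geometric_weight. Qed.

Lemma wt_dbl_conP x y a : x < 1 -> 0 <= x -> y < 1 -> 0 <= y -> (0 < a)%N ->
  wt_dbl x y 2 a = (conP x y a)^-1.
Proof.
move=> x1 x0 y1 y0 a0; have aR : 1 <= a%:R :> R by rewrite ler1n.
have A0 : a%:R != 0 :> R by rewrite lt0r_neq0//; exact: lt_le_trans aR.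
have ax : a%:R - x != 0 by rewrite lt0r_neq0// subr_gt0; exact: lt_le_trans aR.
have ay : a%:R - y != 0 by rewrite lt0r_neq0// subr_gt0; exact: lt_le_trans aR.
by rewrite /wt_dbl /wt_ohno /wt_zeta /conP; field; rewrite A0 ax ay.
Qed.

Lemma wt_dbl1 x y a : (0 < a)%N -> wt_dbl x y 1 a = wt_dbl x y 2 a * a%:R.
Proof.
move=> a0; have A0 : a%:R != 0 :> R by rewrite pnatr_eq0 -lt0n.
rewrite /wt_dbl /wt_ohno /wt_zeta; move: ((1 - y / _)^-1) ((1 - x / _)^-1) => u v.
by field.
Qed.

Lemma wt_dbl3 x y a : (0 < a)%N -> wt_dbl x y 3 a = wt_dbl x y 2 a / a%:R.
Proof.
by move=> _; rewrite /wt_dbl /wt_ohno /wt_zeta exprS invfM; ring.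
Qed.

Lemma wt_dbl2_le x y a : 0 < x -> 4 * x <= 1 -> 0 < y -> 4 * y <= 1 ->
  (0 < a)%N -> wt_dbl x y 2 a <= 4 / (a%:R * a.+1%:R).
Proof.
move=> x0 x4 y0 y4 a0; rewrite wt_dbl_conP ?(ltW x0) ?(ltW y0)//; try lra.
case: a a0 => [//|a] _.
have a1 : 1 <= a.+1%:R :> R by rewrite ler1n.
rewrite ler_pdivlMr ?mulr_gt0// mulrC ler_pdivrMr ?conP_gt0//.
rewrite /conP -[a.+2%:R]natr1; move: (a.+1%:R) a1 => N N1.
(* Both factors are nonnegative since x, y <= 1/4 <= N/4; the goal is N (N + 1) <= 4 P(N). *)
have h : 0 <= (N - x - 3 / 4 * N) * (N - y - 3 / 4 * N).
  by rewrite mulr_ge0//; lra.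
nra.
Qed.

(** At (0, 0) the transport leaves C on the axes, where it is the positive constant K; this factors
    out and cancels. *)
Lemma chain_dbl_dual (x y : R) s : 0 < x -> 4 * x <= 1 -> 0 < y -> 4 * y <= 1 ->
  chain (wt_dbl x y) (word s) (fun=> 1%E) 0 =
  chain (wt_dbl x y) (word (rev s)) (fun=> 1%E) 0.
Proof.
move=> x0 x4 y0 y4; have xyP : [/\ 0 < x, 4 * x <= 1, 0 < y & 4 * y <= 1] by [].
have [x1 y1] : x < 1 /\ y < 1 by lra.
have [x0' y0'] := (ltW x0, ltW y0).
have wt0 c a : 0 <= wt_dbl x y c a by rewrite wt_dbl_ge0.
(* The weight of 2 and 1/P differ at a = 0, but the tails only involve a > 0. *)
have E (G : nat -> \bar R) m :
    (\sum_(0 <= a <oo | (m < a)%N) (wt_dbl x y 2 a)%:E * G a =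
     \sum_(0 <= a <oo | (m < a)%N) ((conP x y a)^-1)%:E * G a)%E.
  apply: eq_eseriesr => a /(leq_ltn_trans (leq0n _)) a0.
  by rewrite wt_dbl_conP.
have K0 := conK_gt0 xyP.
have := @word_transport00 R (wt_dbl x y) (conC x y) (conD x y) wt0
  (conC_ge0 xyP) (conD_ge0 xyP) (conC_sym xyP) (@conDC _ x y) (@wt_dbl3 x y).
rewrite (eq_fun (fun a => congr1 EFin (conCn0 x y a))).
rewrite (eq_fun (fun a => congr1 EFin (conC0n x y a))).
have KE k : chain (wt_dbl x y) k (fun=> (conK x y)%:E) 0 =
    ((conK x y)%:E * chain (wt_dbl x y) k (fun=> 1) 0)%E.
  by rewrite -chainZ//; congr chain; apply/funext => a; rewrite mule1.
move=> /(_ _ _ _ s); rewrite !KE => H.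
have {}H : ((conK x y)%:E * chain (wt_dbl x y) (word s) (fun=> 1) 0 =
    (conK x y)%:E * chain (wt_dbl x y) (word (rev s)) (fun=> 1) 0)%E.
  apply: H.
  - by move=> m n; rewrite !E conC_transport.
  - by move=> m n; rewrite !E conD_transport.
  - move=> m n n0; rewrite -conD_tail//; apply: eq_eseriesr => a.
    move=> /(leq_ltn_trans (leq0n _)) a0.
    by rewrite wt_dbl1// wt_dbl_conP// [_^-1 * _]mulrC.
have := congr1 (fun t => ((conK x y)^-1)%:E * t)%E H.
by rewrite !muleA -!EFinM mulVf ?gt_eqF// !mul1e.
Qed.

(** * Coefficients of the double generating function *)

Definition zeta_ext (k : seq nat) : \bar R := chain wt_zeta k (fun=> 1%E) 0.

Lemma zetaE k : zeta R k = fine (zeta_ext k).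
Proof. by rewrite /zeta_ext /wt_zeta chain_esum. Qed.

Lemma zeta_ext_ge0 k : (0 <= zeta_ext k)%E.
Proof. by apply: chain_ge0 => // c a; exact: wt_zeta_ge0. Qed.

Definition dbl_ohno (k : seq nat) (m1 m2 : nat) : \bar R :=
  (\sum_(e1 <- wcomp (size k) m1) \sum_(e2 <- wcomp (size k) m2)
     zeta_ext (k \oplus e1 \oplus e2))%E.

Lemma dbl_ohno_ge0 k m1 m2 : (0 <= dbl_ohno k m1 m2)%E.
Proof.
by apply: sume_ge0 => e1 _; apply: sume_ge0 => e2 _; exact: zeta_ext_ge0.
Qed.

Lemma size_index_add (k e : seq nat) m :
  e \in wcomp (size k) m -> size (k \oplus e) = size k.
Proof.
by rewrite mem_wcomp => /andP[/eqP se _]; rewrite size_map size_zip se minnn.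
Qed.

(** Expanding the weights in x produces the vectors [e1], and then in y the vectors [e2]. *)
Lemma chain_dbl_series (x y : R) k : 0 <= x -> x < 1 -> 0 <= y -> y < 1 ->
  (chain (wt_dbl x y) k (fun=> 1) 0 =
   \sum_(0 <= m1 <oo) (x ^+ m1)%:E *
     \sum_(0 <= m2 <oo) (y ^+ m2)%:E * dbl_ohno k m1 m2)%E.
Proof.
move=> x0 x1 y0 y1.
rewrite (@chain_series _ x _ (wt_ohno y))//; last 2 first.
- by move=> c a; rewrite wt_ohno_ge0.
- by move=> c a a0; rewrite wt_dblE.
apply: eq_eseriesr => m1 _; congr (_ * _)%E.
transitivity (\sum_(e1 <- wcomp (size k) m1) \sum_(0 <= m2 <oo)
    (y ^+ m2)%:E * \sum_(e2 <- wcomp (size k) m2) zeta_ext (k \oplus e1 \oplus e2))%E.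
  rewrite !big_seq; apply: eq_bigr => e1 e1P.
  rewrite (@chain_series _ y _ wt_zeta)//; last 2 first.
  - exact: wt_zeta_ge0.
  - by move=> c a a0; rewrite wt_ohnoE.
  by rewrite (size_index_add e1P).
rewrite -nneseries_sum; last first.
  move=> e1 m2 _; rewrite mule_ge0 ?lee_fin ?exprn_ge0//.
  by apply: sume_ge0 => e2 _; exact: zeta_ext_ge0.
apply: eq_eseriesr => m2 _; rewrite ge0_sume_distrr// => e1 _.
by apply: sume_ge0 => e2 _; exact: zeta_ext_ge0.
Qed.

Lemma dbl_ohno_dual s m1 m2 :
  dbl_ohno (word s) m1 m2 \is a fin_num /\
  dbl_ohno (word s) m1 m2 = dbl_ohno (word (rev s)) m1 m2.
Proof.
pose d : R := 4^-1.
have d0 : 0 < d by rewrite invr_gt0.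
have d4 : 4 * d = 1 by rewrite mulfV.
have d1 x : x <= d -> x < 1 /\ 4 * x <= 1.
  by move: (d) d4 => D d4 xd; split; lra.
(* The coefficient of x^m in the generating function of [word t], still a series in y. *)
pose A t m y := (\sum_(0 <= m2 <oo) (y ^+ m2)%:E * dbl_ohno (word t) m m2)%E.
have A0 t m y : 0 < y -> (0 <= A t m y)%E.
  move=> y0; apply: nneseries_ge0 => i _ _.
  by rewrite mule_ge0 ?dbl_ohno_ge0// lee_fin exprn_ge0// ltW.
have fin t y : 0 < y <= d -> (\sum_(0 <= m <oo) (d ^+ m)%:E * A t m y < +oo)%E.
  move=> /andP[y0 /d1[y1 y4]]; rewrite -chain_dbl_series ?(ltW d0) ?(ltW y0)//.
    apply: chain_word_lty.
    - by move=> c a; rewrite wt_dbl_ge0 ?(ltW d0) ?(ltW y0)//; have [] := d1 d (lexx _).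
    - by move=> a a0; rewrite wt_dbl2_le// d4.
    - by move=> a a0; rewrite wt_dbl1.
    - by move=> a a0; rewrite wt_dbl3.
  by have [] := d1 d (lexx _).
(* Coefficients in x are compared for each fixed y; those in y follow at the end. *)
have AE m y : 0 < y <= d -> A s m y = A (rev s) m y.
  move=> yd; have /andP[y0 /d1[y1 y4]] := yd.
  apply: (@powser_eq _ (fun m => A s m y) (fun m => A (rev s) m y) d) => //;
    try by move=> i; exact: A0.
    move=> x /andP[x0 /d1[x1 x4]].
    by rewrite -!chain_dbl_series ?(ltW x0) ?(ltW y0)// chain_dbl_dual.
  exact: fin.
have finA t m : (A t m d < +oo)%E.
  have dd : 0 < d <= d by rewrite d0 lexx.
  have := powser_fin_coef d0 (fun i => A0 t i d d0) (fin t d dd) m.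
  by rewrite ge0_fin_numE// A0.
split; first exact: (powser_fin_coef d0 (dbl_ohno_ge0 _ _) (finA s m1)).
apply: (powser_eq d0 (dbl_ohno_ge0 _ _) (dbl_ohno_ge0 _ _)) => [y yd|].
  exact: AE.
exact: finA.
Qed.

(** A finite sum in [\bar R] with finite value has only finite terms, so [fine] may be taken
    termwise. *)
Lemma sum_zeta_dbl_ohno k m1 m2 : dbl_ohno k m1 m2 \is a fin_num ->
  \sum_(e1 <- wcomp (size k) m1) \sum_(e2 <- wcomp (size k) m2)
    zeta R (k \oplus e1 \oplus e2) = fine (dbl_ohno k m1 m2).
Proof.
move=> /sum_fin_numP fin1; rewrite /dbl_ohno.
rewrite big_seq [in RHS]big_seq -sum_fine => [|e1 e1P]; last exact: fin1.
apply: eq_bigr => e1 e1P; have /sum_fin_numP fin2 := fin1 e1 e1P isT.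
rewrite big_seq [in RHS]big_seq -sum_fine => [|e2 e2P]; last exact: fin2.
by apply: eq_bigr => e2 _; rewrite zetaE.
Qed.

End DoubleOhno.

Theorem theorem1p4 (R : realType) (d : nat) (n : (2 * d).+1.-tuple nat)
    (hn : (d, nth 0%N n 0) != (0%N, 0%N)) :
  let k := index_213 n in
  let k' := dual k in
  let r := size k in
  let r' := size k' in
  (forall m : nat,
     \sum_(e <- wcomp r m) ohno_series R (k \oplus e) =
     \sum_(e' <- wcomp r' m) ohno_series R (k' \oplus e')) /\
  (forall m1 m2 : nat,
     \sum_(e1 <- wcomp r m1) \sum_(e2 <- wcomp r m2)
        zeta R (k \oplus e1 \oplus e2) =
     \sum_(e1' <- wcomp r' m1) \sum_(e2' <- wcomp r' m2)
        zeta R (k' \oplus e1' \oplus e2')).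
Proof.
move=> k k' r r'.
have dbl m1 m2 : \sum_(e1 <- wcomp r m1) \sum_(e2 <- wcomp r m2)
      zeta R (k \oplus e1 \oplus e2) =
    \sum_(e1 <- wcomp r' m1) \sum_(e2 <- wcomp r' m2)
      zeta R (k' \oplus e1 \oplus e2).
  rewrite {}/r {}/r' {}/k' /k; have [s ->] := index_213_word n.
  rewrite dual_word; have [fin E] := @dbl_ohno_dual R s m1 m2.
  by rewrite !sum_zeta_dbl_ohno// -?E.
(* The coefficient of X^m2 is the double sum with m1 = m, since adding [e] keeps the depth. *)
split => // m; apply/funext => m2; rewrite !fct_sumE.
have ohnoE l : \sum_(e <- wcomp (size l) m) ohno_series R (l \oplus e) m2 =
    \sum_(e <- wcomp (size l) m) \sum_(e2 <- wcomp (size l) m2)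
      zeta R (l \oplus e \oplus e2).
  rewrite !big_seq; apply: eq_bigr => e eP.
  by rewrite /ohno_series /ohno (size_index_add eP).
by rewrite !ohnoE dbl.
Qed.
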